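(* Let $N(B_n,x)$ be the type $B$ Narayana polynomials, and let $B_n(x)$ be the type $B$ Eulerian polynomials. Then for $n\ge1$, $$n!\,N(B_n,x)=\sum_{T\in\mathrm{SYT}(n)}\prod_{i=1}^n\sigma_i(T)\,\bigl(B_i(x)\bigr)^{w_i(T)}.$$
   Context: $N(B_n,x)=\sum_{k=0}^n\binom nk^2x^k$. $B_n(x)=\sum_{\sigma\in\mathcal B_n}x^{\mathrm{des}_B(\sigma)}$, where $\mathcal B_n$ is the hyperoctahedral group of signed permutations $\sigma=\sigma(1)\cdots\sigma(n)$ of $\{\pm1,\dots,\pm n\}$ (with $\sigma(-i)=-\sigma(i)$) and $\mathrm{des}_B(\sigma)=\#\{i\in\{0,1,\dots,n-1\}:\sigma(i)>\sigma(i+1)\}$ with $\sigma(0)=0$. A standard Young tableau of size $n$ is a filling of the Ferrers diagram of a partition $\lambda\vdash n$ (French convention: left-justified rows numbered from bottom to top, $\lambda_i$ boxes in row $i$) with $1,\dots,n$, each used exactly once, increasing from left to right in rows and from bottom to top in columns; $\mathrm{SYT}(n)$ is the set of all of them, over all $\lambda\vdash n$. For $T\in\mathrm{SYT}(n)$, $w_i(T)$ is the number of rows of $T$ with exactly $i$ boxes, $T_i$ is the tableau obtained from $T$ by deleting the entries $i+1,\dots,n$, and $\mathrm{col}_k(T_i)$ is the number of boxes in the $k$-th column of $T_i$. The box sorting index of $i$ is $$\sigma_i(T)=\begin{cases} i-\mathrm{col}_1(T_i)+1, & \text{if } i \text{ is in the first column of } T,\\ \mathrm{col}_k(T_i)-\mathrm{col}_{k+1}(T_i)+1,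 & \text{if } i \text{ is in the } (k+1)\text{-th column of } T,\ k\ge1.\end{cases}$$ *)

(* Defs.v *)
From HB Require Import structures.
From mathcomp Require Import all_boot all_order all_algebra all_fingroup.

Set Implicit Arguments.
Unset Strict Implicit.
Unset Printing Implicit Defensive.

Import Order.TTheory GRing.Theory Num.Theory.
Local Open Scope ring_scope.

Definition narayanaB (n : nat) : {poly int} :=
  \sum_(k < n.+1) ('C(n, k) ^ 2)%N%:R *: 'X^k.

(* The set {+-1, ..., +-n}: (j, false) is j + 1 and (j, true) is - (j + 1). *)
Definition letter (n : nat) : finType := ('I_n * bool)%type.

Definition letter_val (n : nat) (a : letter n) : int :=
  if a.2 then - (a.1.+1)%:Z else (a.1.+1)%:Z.

Definition letter_opp (n : nat) (a : letter n) : letter n := (a.1, ~~ a.2).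

Definition hyperoctahedral (n : nat) : {set {perm letter n}} :=
  [set s : {perm letter n} | [forall a, s (letter_opp a) == letter_opp (s a)]].

(* The word sigma(0) sigma(1) ... sigma(n), with sigma(0) = 0. *)
Definition signed_word (n : nat) (s : {perm letter n}) : seq int :=
  0 :: [seq letter_val (s (j, false)) | j <- enum 'I_n].

Definition desB (n : nat) (s : {perm letter n}) : nat :=
  #|[set i : 'I_n | (signed_word s)`_i > (signed_word s)`_i.+1]|.

Definition eulerianB (n : nat) : {poly int} :=
  \sum_(s in hyperoctahedral n) 'X^(desB s).

(* A partial filling of the n x n grid by 1, ..., n: T (r, c) is the entry of
   the box in row r + 1 (from the bottom) and column c + 1, and 0 means that
   there is no box there.  The Ferrers diagram of a partition of n fits in this
   grid. *)
Definition filling (n : nat) : finType := {ffun 'I_n * 'I_n -> 'I_n.+1}.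

(* Partitions of n, padded with zero parts; la r is the (r + 1)-st part. *)
Definition is_partition (n : nat) (la : {ffun 'I_n -> 'I_n.+1}) : bool :=
  [forall r : 'I_n, forall r' : 'I_n, (r <= r')%N ==> (la r' <= la r)%N]
  && (\sum_r la r == n)%N.

Definition is_standard (n : nat) (la : {ffun 'I_n -> 'I_n.+1})
    (T : filling n) : bool :=
  [&& [forall r : 'I_n, forall c : 'I_n,
         (0 < T (r, c))%N == (c < la r)%N],
      [forall e : 'I_n.+1, (0 < e)%N ==> (#|[set b | T b == e]| == 1%N)],
      [forall r : 'I_n, forall c : 'I_n, forall c' : 'I_n,
         (c < c' < la r)%N ==> (T (r, c) < T (r, c'))%N]
    & [forall c : 'I_n, forall r : 'I_n, forall r' : 'I_n,
         (r < r')%N && (c < la r')%N ==> (T (r, c) < T (r', c))%N]].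

Definition SYT (n : nat) : {set filling n} :=
  [set T : filling n |
    [exists la : {ffun 'I_n -> 'I_n.+1}, is_partition la && is_standard la T]].

(* w_i(T); meaningful for i > 0, as empty rows of the grid have 0 boxes. *)
Definition num_rows (n : nat) (i : nat) (T : filling n) : nat :=
  #|[set r : 'I_n | #|[set c : 'I_n | (0 < T (r, c))%N]| == i]|.

Definition subtableau (n : nat) (T : filling n) (i : nat) : filling n :=
  [ffun b => if (T b <= i)%N then T b else ord0].

(* Number of boxes in the k-th column, where columns are numbered from 1. *)
Definition col_size (n : nat) (k : nat) (T : filling n) : nat :=
  #|[set b : 'I_n * 'I_n | (b.2.+1 == k) && (0 < T b)%N]|.

(* If i lies in the box b, its column has number b.2 + 1, so that b.2 is 0 for
   the first column and is k for the (k+1)-th column.  The value 0 is a dummy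
   for i not an entry of T. *)
Definition sorting_index (n : nat) (T : filling n) (i : nat) : int :=
  if [pick b | T b == i :> nat] is Some b then
    let k := nat_of_ord b.2 in
    if k == 0%N then i%:Z - (col_size 1 (subtableau T i))%:Z + 1
    else (col_size k (subtableau T i))%:Z - (col_size k.+1 (subtableau T i))%:Z + 1
  else 0.

(* Main.v *)
Require Import Defs.
From mathcomp Require Import all_boot all_order all_algebra all_fingroup.
From mathcomp Require Import ring zify.

(** Both sides satisfy, as functions of n, the same recurrence.  Put
    theta p = 2 X (1 - X) p'.

    For the Narayana polynomials N_n, comparing coefficients gives
    (n+1) N_(n+1) = (n+1 + (3n+1) X) N_n + theta N_n (narayanaB_rec).

    For the Eulerian polynomials, inserting +-(n+1) into the word of a signed
    permutation gives B_(n+1) = (1 + (2n+1) X) B_n + theta B_n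
    (eulerianB_rec).

    A standard tableau grows box by box.  The sorting index of a box outside of
    the first column is the number of rows that it could have extended, and that
    of entry n+1 in the first column is n+1-r, where r is the old number of rows.
    So the weighted sum over all ways to add one box to a tableau lets each of
    its rows grow in turn, and starts a new row n+1-r times.  On the product of
    the B_k over the rows, theta acts by the Leibniz rule; by the Eulerian
    recurrence it lets each row grow in turn, up to corrections that depend only
    on the lengths of the rows and add up to a function of n and r.  Together
    (sum_box_weight) this says that the sum F_n over the tableaux satisfies
    F_(n+1) = (n+1 + (3n+1) X) F_n + theta F_n, hence F_n = n! N_n.

    To make the growth of tableaux an honest recursion, a tableau is replaced by
    the word of the columns of its entries 1, ..., n.  These words are the
    lattice words, which are generated one letter at a time; perm_col_words is
    the bijection, and sorting_indexE and num_rowsE translate the statistics. *)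

Set Implicit Arguments.
Unset Strict Implicit.
Unset Printing Implicit Defensive.

Import Order.TTheory GRing.Theory Num.Theory.
Local Open Scope ring_scope.

(** * The derivation and the Narayana recurrence *)

(** Eulerian, Narayana and tableau polynomials all move from size n to size n+1
    by this derivation plus multiplication by a linear polynomial. *)
Definition theta (p : {poly int}) : {poly int} := 2%:R * 'X * (1 - 'X) * p^`().

Lemma thetaM p q : theta (p * q) = theta p * q + p * theta q.
Proof. by rewrite /theta derivM; ring. Qed.

Lemma theta1 : theta 1 = 0.
Proof. by rewrite /theta derivC mulr0. Qed.

Lemma thetaX p m : theta (p ^+ m.+1) = m.+1%:R * p ^+ m * theta p.
Proof. rewrite /theta deriv_exp /= -mulr_natl; ring. Qed.

Lemma theta_sum (I : Type) (r : seq I) (F : I -> {poly int}) :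
  theta (\sum_(i <- r) F i) = \sum_(i <- r) theta (F i).
Proof. by rewrite /theta raddf_sum mulr_sumr. Qed.

Lemma thetaZ c p : theta (c *: p) = c *: theta p.
Proof. by rewrite /theta derivZ scalerAr. Qed.

Lemma theta_prod (I : finType) (F : I -> {poly int}) :
  theta (\prod_i F i) = \sum_i theta (F i) * \prod_(j | j != i) F j.
Proof.
have gen (r : seq I) : uniq r -> theta (\prod_(i <- r) F i) =
    \sum_(i <- r) theta (F i) * \prod_(j <- r | j != i) F j.
  elim: r => [|a r IH] /=; first by rewrite !big_nil theta1.
  case/andP=> nar ur; rewrite !big_cons thetaM IH // eqxx mulr_sumr; congr (_ + _).
    congr (_ * _); rewrite big_seq [RHS]big_seq_cond.
    apply: eq_bigl => j; case: (boolP (j \in r)) => //= jr.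
    by apply/esym; apply: contraNneq nar => <-.
  rewrite big_seq [RHS]big_seq; apply: eq_bigr => i ir.
  rewrite big_cons ifT; first by ring.
  by apply: contraNneq nar => ->.
exact: (gen _ (index_enum_uniq I)).
Qed.

(** The linear coefficient common to the Narayana and the tableau recurrences. *)
Definition rate (n : nat) : {poly int} := (n.+1)%:R + (3 * n + 1)%:R * 'X.

Lemma coef_narayanaB n k : (narayanaB n)`_k = ('C(n, k) ^ 2)%:R.
Proof.
rewrite /narayanaB; under eq_bigr => i _ do rewrite -[_%:R]/(_%:R : int).
rewrite -(poly_def n.+1 (fun k => ('C(n, k) ^ 2)%:R)) coef_poly.
by case: ltnP => // lt_nk; rewrite bin_small.
Qed.

(** Write a = 'C(n, k+1) and b = 'C(n, k).  By Pascal's rule the coefficients of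
    'X^(k+1) on the two sides differ by 2 (b - a) ((k+1) a - (n-k) b), and
    (k+1) a = (n-k) b. *)
Lemma narayanaB_rec n :
  n.+1%:R * narayanaB n.+1 = rate n * narayanaB n + theta (narayanaB n).
Proof.
have expand (N : {poly int}) : rate n * N + theta N =
    N *+ n.+1 + ('X * N) *+ (3 * n + 1)
    + ('X * N^`()) *+ 2 - ('X * ('X * N^`())) *+ 2.
  by rewrite /rate /theta; ring.
rewrite {}expand mulr_natl.
apply/polyP => -[|k]; rewrite !(coefB, coefD, coefMn, coefXM) /=.
  by rewrite !coef_narayanaB !bin0 !mul0rn !addr0 ?subr0.
have coefXd j : (if j == 0%N then 0 else (narayanaB n)^`()`_j.-1) =
    ('C(n, j) ^ 2)%:R *+ j.
  by case: j => [|j]; rewrite ?mulr0n // coef_deriv coef_narayanaB.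
rewrite coefXd coef_deriv !coef_narayanaB binS.
have [lt_nk|le_kn] := ltnP n k.
  by rewrite (bin_small (leqW lt_nk)) (bin_small lt_nk); ring.
have /(congr1 (fun m : nat => m%:R : int)) := mul_bin_left n k.
rewrite !natrX !natrD !natrM natrB //.
move: ('C(n, k)%:R : int) ('C(n, k.+1)%:R : int) => b a.
move=> /eqP; rewrite -subr_eq0 => /eqP H.
(* The difference of the two sides is 2 (b - a) times that of the sides of H. *)
by apply/eqP; rewrite -subr_eq0 -(mulr0 (2%:R * (b - a))) -H; apply/eqP; ring.
Qed.

(** * The Eulerian recurrence, by insertion into signed words *)

Section Inserts.
Variable T : eqType.
Implicit Types (v : T) (w u : seq T).

Fixpoint inserts v w : seq (seq T) :=
  if w is y :: w' then (v :: w) :: [seq y :: u | u <- inserts v w'] else [:: [:: v]].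

Lemma perm_inserts v w u : u \in inserts v w -> perm_eq u (v :: w).
Proof.
elim: w u => [|y w IH] u /=; first by rewrite inE => /eqP->.
rewrite inE => /predU1P[->//|/mapP[u' /IH pu ->]].
apply: (@perm_trans _ (y :: v :: w)); first by rewrite perm_cons.
exact/permEl/(perm_catCA [:: y] [:: v] w).
Qed.

Lemma mem_inserts_rem v u : v \in u -> u \in inserts v (rem v u).
Proof.
elim: u => [|y u IH] //=; rewrite inE eq_sym; have [->|nyv] /= := eqVneq y v.
  by case: u {IH} => [|z u] _; rewrite /= ?inE eqxx.
by move=> /IH vu; rewrite inE map_f ?orbT.
Qed.

Lemma filter_inserts (p : pred T) v w u :
  ~~ p v -> u \in inserts v w -> filter p u = filter p w.
Proof.
move=> npv; elim: w u => [|y w IH] u /=.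
  by rewrite inE => /eqP-> /=; rewrite (negPf npv).
rewrite inE => /predU1P[->/=|/mapP[u' /IH pu -> /=]]; last by rewrite pu.
by rewrite (negPf npv).
Qed.

Lemma uniq_inserts v w : v \notin w -> uniq (inserts v w).
Proof.
elim: w => [|y w IH] //=; rewrite inE negb_or => /andP[nvy /IH uw].
rewrite map_inj_uniq ?uw ?andbT; last by move=> ? ? [].
by apply/mapP => -[u _ [/eqP]]; rewrite (negPf nvy).
Qed.
End Inserts.

Fixpoint descents (a : int) (w : seq int) : nat :=
  if w is y :: w' then ((y < a)%R + descents y w')%N else 0%N.

Lemma descents_sum a w :
  descents a w = (\sum_(i < size w) ((a :: w)`_i.+1 < (a :: w)`_i)%R)%N.
Proof.
elim: w a => [|y w IH] a /=; first by rewrite big_ord0.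
by rewrite big_ord_recl /= IH.
Qed.

(** A maximal letter put last adds no descent; put before a letter, it adds
    a descent of its own and destroys the one that was there, if any.  So it
    raises the number of descents exactly when put between two letters that do
    not form a descent. *)
Lemma sum_inserts_max (N a : int) w :
  all (fun y => y < N) (a :: w) ->
  \sum_(u <- inserts N w) 'X^(descents a u) =
  (descents a w).+1%:R * 'X^(descents a w)
  + ((size w)%:R - (descents a w)%:R) * 'X^((descents a w).+1) :> {poly int}.
Proof.
elim: w a => [|y w IH] a /= /andP[aN].
  by move=> _; rewrite big_seq1 /= ltNge (ltW aN) /=; ring.
move=> /[dup] yw /andP[yN _]; rewrite big_cons big_map /= yN ltNge (ltW aN) /=.
under eq_bigr => u _ do rewrite exprD.
rewrite -mulr_sumr IH //=; move: (descents y w) => d.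
by case: (y < a); rewrite ?add0n ?add1n -!natr1 !exprS; ring.
Qed.

(** A minimal letter creates a descent before it and an ascent after it, so it
    raises the number of descents when put last or between two letters that do
    not form a descent. *)
Lemma sum_inserts_min (N a : int) w :
  all (fun y => N < y) (a :: w) ->
  \sum_(u <- inserts N w) 'X^(descents a u) =
  (descents a w)%:R * 'X^(descents a w)
  + ((size w).+1%:R - (descents a w)%:R) * 'X^((descents a w).+1) :> {poly int}.
Proof.
elim: w a => [|y w IH] a /= /andP[aN].
  by move=> _; rewrite big_seq1 /= aN /=; ring.
move=> /[dup] yw /andP[yN _]; rewrite big_cons big_map /= aN ltNge (ltW yN) /=.
under eq_bigr => u _ do rewrite exprD.
rewrite -mulr_sumr IH //=; move: (descents y w) => d.
by case: (y < a); rewrite ?add0n ?add1n -!natr1 !exprS; ring.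
Qed.

(** The words of the signed permutations, generated by inserting +-n into those
    of size n-1: the form on which the Eulerian recurrence can be read off. *)
Fixpoint signed_words (n : nat) : seq (seq int) :=
  if n is m.+1 then
    [seq u | w <- signed_words m, u <- inserts (m.+1)%:Z w ++ inserts (- (m.+1)%:Z) w]
  else [:: [::]].

Lemma mem_signed_words n w :
  (w \in signed_words n) = perm_eq [seq absz v | v <- w] (iota 1 n).
Proof.
elim: n w => [|n IH] u; last rewrite /signed_words -/signed_words.
  rewrite inE; case: u => //= a u; apply/esym/negbTE.
  by apply/negP => /perm_size.
have iotaS : perm_eq (iota 1 n.+1) (n.+1 :: iota 1 n).
  by rewrite -{1}[n.+1]addn1 iotaD add1n perm_catC.
apply/allpairsPdep/idP => [[w [u' [ww]]]|pu].
  rewrite mem_cat => /orP[] /perm_inserts pu ->;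
  apply: perm_trans (perm_map _ pu) _;
  rewrite /= ?abszN ?absz_nat (permPr iotaS) perm_cons;
  by rewrite -IH.
have : n.+1 \in [seq absz v | v <- u] by rewrite (perm_mem pu) mem_iota; lia.
case/mapP => v vu Ev; exists (rem v u), u; split=> //.
  rewrite IH -(perm_cons n.+1) -(permPr iotaS) -(permPr pu) perm_sym Ev.
  by rewrite -[absz v :: _]/(map absz (v :: _)) perm_map // perm_to_rem.
have [E|E] : v = n.+1%:Z \/ v = - n.+1%:Z by lia.
  by rewrite mem_cat -E mem_inserts_rem.
by rewrite mem_cat -E mem_inserts_rem ?orbT.
Qed.

Lemma signed_words_bound n w v : w \in signed_words n -> v \in w -> (absz v <= n)%N.
Proof.
rewrite mem_signed_words => /perm_mem E vw.
have := E (absz v); rewrite map_f // mem_iota; lia.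
Qed.

Lemma size_signed_words n w : w \in signed_words n -> size w = n.
Proof. by rewrite mem_signed_words => /perm_size; rewrite size_map size_iota. Qed.

Lemma uniq_signed_words n : uniq (signed_words n).
Proof.
elim: n => [|n IH] //=; apply: allpairs_uniq_dep => // [w ww|].
  have nw v : absz v = n.+1 -> v \notin w.
    by move=> Ev; apply/negP => /(signed_words_bound ww); lia.
  rewrite cat_uniq !uniq_inserts ?nw //.
  rewrite /= andbT; apply/hasPn => u /perm_inserts /perm_mem pu.
  apply/negP => /perm_inserts /perm_mem pu'.
  have := pu' (n.+1)%:Z; rewrite inE eqxx /= pu inE (negPf (nw _ _)) //; lia.
(* The word of size n is recovered by erasing the letters +-(n+1). *)
have fP w u : w \in signed_words n ->
    u \in inserts n.+1%:Z w ++ inserts (- n.+1%:Z) w -> w = [seq v <- u | absz v != n.+1].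
  move=> ww; rewrite mem_cat => /orP[] /filter_inserts-> //=;
  rewrite ?abszN ?absz_nat ?eqxx //; symmetry; apply/all_filterP/allP => v;
  by move/(signed_words_bound ww); lia.
move=> p q /allpairsPdep[w [u [ww uu ->]]] /allpairsPdep[w' [u' [ww' uu' ->]]] /= E.
by subst u'; rewrite (fP _ _ ww uu) -(fP _ _ ww' uu').
Qed.

(** A word with d descents has 2d+1 extensions with d descents (n+1 last, or
    +-(n+1) in one of the d descents) and 2n+1-2d with d+1. *)
Lemma signed_words_rec n :
  \sum_(w <- signed_words n.+1) ('X^(descents 0 w) : {poly int}) =
  (1 + (2 * n + 1)%:R * 'X) * (\sum_(w <- signed_words n) 'X^(descents 0 w))
  + theta (\sum_(w <- signed_words n) 'X^(descents 0 w)).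
Proof.
rewrite big_allpairs_dep /= theta_sum mulr_sumr -big_split /= !big_seq.
apply: eq_bigr => w ww; have sw := size_signed_words ww.
rewrite big_cat /= sum_inserts_max ?sum_inserts_min; first last.
- by rewrite /=; apply/allP => v /(signed_words_bound ww); lia.
- by rewrite /=; apply/allP => v /(signed_words_bound ww); lia.
rewrite sw; case: (descents 0 w) => [|d].
  by rewrite expr0 theta1 -!natr1; ring.
by rewrite thetaX /theta derivX -!natr1 !exprS; ring.
Qed.

Definition word_of n (s : {perm letter n}) : seq int :=
  [seq letter_val (s (j, false)) | j <- enum 'I_n].

Lemma desBE n (s : {perm letter n}) : desB s = descents 0 (word_of s).
Proof.
rewrite descents_sum /desB /signed_word -sum1dep_card big_mkcond /=.
rewrite size_map size_enum_ord.
by apply: eq_bigr => i _; case: (_ < _).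
Qed.

Lemma absz_letter_val n (a : letter n) : absz (letter_val a) = a.1.+1.
Proof. by case: a => j []; rewrite /letter_val /= ?abszN. Qed.

Lemma letter_val_inj n : injective (@letter_val n).
Proof.
move=> [i b] [j c]; case: b; case: c; rewrite /letter_val /= => E;
  try (have /val_inj -> // : i = j :> nat by lia); exfalso; lia.
Qed.

Lemma hyperoctahedral_opp n (s : {perm letter n}) a :
  s \in hyperoctahedral n -> s (letter_opp a) = letter_opp (s a).
Proof. by rewrite inE => /forallP/(_ a)/eqP. Qed.

Lemma word_of_signed n (s : {perm letter n}) :
  s \in hyperoctahedral n -> word_of s \in signed_words n.
Proof.
move=> sH; rewrite mem_signed_words -map_comp.
have -> : map (absz \o (fun j => letter_val (s (j, false)))) (enum 'I_n) =
    map (fun j => (s (j, false)).1.+1) (enum 'I_n).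
  by apply: eq_map => j /=; rewrite absz_letter_val.
have us : uniq [seq (s (j, false)).1.+1 | j <- enum 'I_n].
  rewrite map_inj_uniq ?enum_uniq // => i j [/val_inj E].
  (* With opposite signs, s (i, false) would be s (j, true). *)
  have [E2|E2] := eqVneq (s (i, false)).2 (s (j, false)).2.
    have /perm_inj[] // : s (i, false) = s (j, false).
    by rewrite [LHS]surjective_pairing E E2 -surjective_pairing.
  have /perm_inj[] // : s (i, false) = s (letter_opp (j, false)).
  rewrite hyperoctahedral_opp // /letter_opp -E.
  by case: (s (i, false)) (s (j, false)) E2 => [a b] [a' b'] /=; case: b; case: b'.
apply: uniq_perm => //; first exact: iota_uniq.
have [] // := uniq_min_size us (s2 := iota 1 n).
  by move=> k /mapP[j _ ->]; rewrite mem_iota add1n !ltnS ltn_ord.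
by rewrite size_iota size_map size_enum_ord.
Qed.

Lemma word_of_inj n : {in hyperoctahedral n &, injective (@word_of n)}.
Proof.
move=> s t sH tH E; apply/permP => -[j b].
have {}E i : s (i, false) = t (i, false).
  by apply: letter_val_inj; move/eq_in_map: E; apply; rewrite mem_enum.
case: b => //; rewrite -[(j, true)]/(letter_opp (j, false)) !hyperoctahedral_opp //.
by rewrite E.
Qed.

Lemma word_of_surj n (w : seq int) : w \in signed_words n ->
  exists2 s, s \in hyperoctahedral n & w = word_of s.
Proof.
move=> ww; have sw := size_signed_words ww.
have bound v : v \in w -> (0 < absz v <= n)%N.
  move: ww; rewrite mem_signed_words => /perm_mem E vw.
  have := E (absz v); rewrite map_f // mem_iota; lia.
have bnth (j : 'I_n) : (0 < absz (w`_j)%R <= n)%N by apply: bound; rewrite mem_nth ?sw.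
pose g (a : letter n) : letter n :=
  (insubd a.1 (absz (w`_(nat_of_ord a.1))).-1, a.2 (+) (w`_(nat_of_ord a.1) < 0)).
have val_g a : (g a).1 = (absz (w`_(nat_of_ord a.1))).-1 :> nat.
  by case/andP: (bnth a.1) => p0 pn; rewrite /= val_insubd ifT //= prednK.
have g_inj : injective g.
  move=> a a' /[dup] E /(congr1 (fun c => nat_of_ord c.1)); rewrite !val_g => E1.
  have ua : uniq (map absz w).
    by move: ww; rewrite mem_signed_words => /perm_uniq ->; apply: iota_uniq.
  have Ea : a.1 = a'.1.
    apply/val_inj/eqP; rewrite -(nth_uniq 0%N _ _ ua) ?size_map ?sw ?ltn_ord //.
    rewrite !(nth_map 0) ?sw ?ltn_ord //.
    case/andP: (bnth a.1) => p _; case/andP: (bnth a'.1) => p' _.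
    by rewrite -(prednK p) E1 (prednK p').
  move/(congr1 snd): E; rewrite /= Ea => /addIb E2.
  by case: a a' Ea E2 {E1} => [a b] [a' b'] /= -> ->.
exists (perm g_inj).
  rewrite inE; apply/forallP => a; rewrite !permE /g /letter_opp /=.
  by rewrite addNb.
apply: (@eq_from_nth _ 0); first by rewrite size_map size_enum_ord.
rewrite sw => j jn; rewrite (nth_map (Ordinal jn)) ?size_enum_ord //.
rewrite permE; have -> : nth (Ordinal jn) (enum 'I_n) j = Ordinal jn.
  by apply: val_inj; rewrite /= nth_enum_ord.
have := val_g (Ordinal jn, false); have := bnth (Ordinal jn).
rewrite /letter_val /=; move=> /andP[p _] ->; rewrite (prednK p); case: ltP; lia.
Qed.

(** word_of is a bijection from the hyperoctahedral group to signed_words. *)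
Lemma eulerianBE n : eulerianB n = \sum_(w <- signed_words n) 'X^(descents 0 w).
Proof.
rewrite /eulerianB -big_enum /=; under eq_bigr => s _ do rewrite desBE.
rewrite -(big_map (@word_of n) xpredT (fun w => 'X^(descents 0 w))).
apply/perm_big/uniq_perm; rewrite ?uniq_signed_words //.
  rewrite map_inj_in_uniq ?enum_uniq // => s t; rewrite !mem_enum.
  exact: word_of_inj.
move=> w; apply/mapP/idP => [[s sH ->]|/word_of_surj[s sH ->]].
  by apply: word_of_signed; rewrite mem_enum in sH.
by exists s => //; rewrite mem_enum.
Qed.

Lemma eulerianB0 : eulerianB 0 = 1.
Proof. by rewrite eulerianBE big_seq1. Qed.

Lemma eulerianB_rec n :
  eulerianB n.+1 = (1 + (2 * n + 1)%:R * 'X) * eulerianB n + theta (eulerianB n).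
Proof. by rewrite !eulerianBE signed_words_rec. Qed.

(** * Lattice words and the recurrence for the sum over them *)

(** A word w records the columns, numbered from 0, of the entries 1, 2, ... of a
    tableau, so that count_mem k w is the size of column k.  For k > 0 this is
    then the number of rows with exactly k boxes; for k = 0 it is 0. *)
Definition nparts (w : seq nat) (k : nat) : nat :=
  (count_mem k.-1 w - count_mem k w)%N.

Definition extendable (w : seq nat) (k : nat) : bool :=
  (k == 0)%N || (0 < nparts w k)%N.

(** The sorting index of a new box in column k: the number of rows that
    it could extend if k > 0, and the number of entries (the new one included)
    minus the number of old rows if k = 0. *)
Definition box_weight (w : seq nat) (k : nat) : int :=
  if (k == 0)%N then (size w).+1%:Z - (count_mem 0%N w)%:Z else (nparts w k)%:Z.

Fixpoint lattice_words (n : nat) : seq (seq nat) :=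
  if n is m.+1 then
    [seq rcons w k | w <- lattice_words m, k <- [seq k <- iota 0 n | extendable w k]]
  else [:: [::]].

(** The columns have weakly decreasing sizes: they form a Ferrers diagram. *)
Definition lattice (w : seq nat) := forall k, (count_mem k.+1 w <= count_mem k w)%N.

Definition word_weight (w : seq nat) : int :=
  \prod_(i < size w) box_weight (take i w) (nth 0%N w i).

Lemma count_mem_rcons (w : seq nat) j k :
  count_mem j (rcons w k) = (count_mem j w + (k == j))%N.
Proof. by rewrite -cats1 count_cat /= addn0. Qed.

Lemma lattice_rcons w k : lattice w -> extendable w k -> lattice (rcons w k).
Proof.
rewrite /extendable /nparts => lw kw j; rewrite !count_mem_rcons.
have := lw j; case: (k =P j.+1) kw => [-> /=|_ _]; case: (_ =P j) => /=; lia.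
Qed.

Lemma lattice_rconsP w k : lattice w -> lattice (rcons w k) -> extendable w k.
Proof.
rewrite /extendable /nparts => lw lwk; case: k lwk => [|k] //= lwk.
by have := lwk k; rewrite !count_mem_rcons eqxx gtn_eqF // addn0 addn1 subn_gt0.
Qed.

Lemma count_mem_ge N k (w : seq nat) :
  all (gtn N) w -> (N <= k)%N -> count_mem k w = 0%N.
Proof.
move=> aw Nk; apply/eqP; rewrite -leqn0 leqNgt -has_count.
by apply/hasPn => x /(allP aw) /= xN; apply/eqP; lia.
Qed.

Lemma lattice_words_lattice n w :
  w \in lattice_words n -> [/\ size w = n, lattice w & all (gtn n) w].
Proof.
elim: n w => [|n IH] w; rewrite /lattice_words -/lattice_words.
  by rewrite inE => /eqP->.
case/allpairsPdep => [u [k [/IH[su lu au]]]].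
rewrite mem_filter mem_iota => /andP[ku kn] ->; split.
- by rewrite size_rcons su.
- exact: lattice_rcons.
- rewrite all_rcons /=; apply/andP; split; first lia.
  by apply: sub_all au => x /=; lia.
Qed.

(** Lattice words are those all of whose prefixes have a Ferrers diagram. *)
Lemma mem_lattice_words n w :
  size w = n -> (forall i, lattice (take i w)) -> w \in lattice_words n.
Proof.
elim: n w => [|n IH] w; first by case: w.
elim/last_ind: w => // w k _; rewrite size_rcons => -[sw] lw.
have tw i : (i <= n)%N -> take i (rcons w k) = take i w.
  by move=> le_in; rewrite -cats1 takel_cat ?sw.
have lwi i : lattice (take i w).
  have [le|lt] := leqP i n; first by rewrite -tw.
  by rewrite take_oversize ?sw 1?ltnW // -(take_size w) sw -tw.
have ww := IH w sw lwi; rewrite /lattice_words -/lattice_words.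
have [_ lw' aw'] := lattice_words_lattice ww.
apply/allpairsPdep; exists w, k; split=> //.
have kw : extendable w k.
  apply: lattice_rconsP => //; have := lw n.+1.
  by rewrite take_oversize // size_rcons sw.
rewrite mem_filter kw mem_iota /= add0n ltnS leqNgt; apply/negP => nk.
move: kw; rewrite /extendable /nparts; case: k {lw tw} nk => //= k nk.
by rewrite (count_mem_ge aw' nk) sub0n.
Qed.

Lemma nparts_oversize n (w : seq nat) : all (gtn n) w -> nparts w n.+1 = 0%N.
Proof. by move=> aw; rewrite /nparts /= (count_mem_ge aw (leqnn n)). Qed.

Lemma lattice_words_take n w i : w \in lattice_words n -> lattice (take i w).
Proof.
elim: n w => [|n IH] w; first by rewrite inE => /eqP->.
move=> /[dup] /lattice_words_lattice[sw lw _].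
rewrite /lattice_words -/lattice_words => /allpairsPdep[u [k [uw _ Ew]]].
have [su _ _] := lattice_words_lattice uw.
have [le|lt] := leqP i n; first by rewrite Ew -cats1 takel_cat ?su //; apply: IH.
by rewrite take_oversize ?sw.
Qed.

Lemma lattice_mono w c c' :
  lattice w -> (c <= c')%N -> (count_mem c' w <= count_mem c w)%N.
Proof.
move=> lw; elim: c' => [|c' IH]; first by rewrite leqn0 => /eqP->.
by rewrite leq_eqVlt => /predU1P[->//|/IH]; apply: leq_trans.
Qed.

Lemma count_take_lt (w : seq nat) e e' c : (e < e')%N -> (e < size w)%N ->
  nth 0%N w e = c -> (count_mem c (take e w) < count_mem c (take e' w))%N.
Proof.
move=> ee' ew ec; rewrite -[e'](subnKC ee') takeD count_cat.
by rewrite (take_nth 0%N) // count_mem_rcons ec eqxx addn1 leq_addr.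
Qed.

(** Along the prefixes a count grows by steps of at most 1, so it takes all
    intermediate values. *)
Lemma count_take_ivt (w : seq nat) m c r : (m <= size w)%N ->
  (r < count_mem c (take m w))%N ->
  exists e, [/\ (e < m)%N, nth 0%N w e = c & count_mem c (take e w) = r].
Proof.
elim: m => [|m IH] mw; first by rewrite take0.
rewrite (take_nth 0%N) // count_mem_rcons => rc.
have [/(IH (ltnW mw))[e [em Ec Er]]|le] := ltnP r (count_mem c (take m w)).
  by exists e; split=> //; apply: ltnW.
exists m; move: rc; case: eqP => [Em|_]; last by rewrite addn0 ltnNge le.
by rewrite addn1 ltnS => ge; split=> //; apply/eqP; rewrite eqn_leq le ge.
Qed.

Lemma uniq_lattice_words n : uniq (lattice_words n).
Proof.
elim: n => [|n IH] //; rewrite /lattice_words -/lattice_words.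
apply: allpairs_uniq_dep => // [w _|].
  exact/filter_uniq/iota_uniq.
move=> p q /allpairsPdep[w [k [_ _ ->]]] /allpairsPdep[w' [k' [_ _ ->]]] /=.
by move/rcons_inj => -[-> ->].
Qed.

Lemma word_weight_rcons w k :
  word_weight (rcons w k) = word_weight w * box_weight w k.
Proof.
rewrite /word_weight size_rcons big_ord_recr /= -cats1 take_size_cat //.
rewrite nth_cat ltnn subnn.
congr (_ * _); apply: eq_bigr => i _.
by rewrite nth_cat ltn_ord takel_cat 1?ltnW.
Qed.

Lemma sum_count_mem N (w : seq nat) :
  all (gtn N) w -> (\sum_(k < N) count_mem (k : nat) w)%N = size w.
Proof.
elim: w => [|x w IH] /=; first by rewrite big1.
case/andP => xN aw; rewrite big_split /= IH // -add1n; congr (_ + _)%N.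
rewrite (bigD1 (Ordinal xN)) //= eqxx big1 ?addn0 // => i.
by rewrite -val_eqE /= eq_sym => /negPf->.
Qed.

(** Telescoping: every row meets the first column. *)
Lemma sum_nparts N w : lattice w ->
  (\sum_(k < N.+1) nparts w k + count_mem N w = count_mem 0%N w)%N.
Proof.
move=> lw; elim: N => [|N IH]; first by rewrite big_ord1 /nparts subnn.
rewrite big_ord_recr /= -IH /nparts /=.
by rewrite -addnA subnK ?lw.
Qed.

(** Summation by parts: the rows and the columns contain the same boxes. *)
Lemma sum_nparts_size N w : lattice w ->
  (\sum_(k < N.+1) k * nparts w k + N * count_mem N w =
   \sum_(k < N) count_mem (k : nat) w)%N.
Proof.
move=> lw; elim: N => [|N IH]; first by rewrite big_ord1 big_ord0.
rewrite big_ord_recr [in RHS]big_ord_recr -IH [RHS]/= -[LHS]addnA -[RHS]addnA; congr addn.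
rewrite -[LHS]/(N.+1 * nparts w N.+1 + N.+1 * count_mem N.+1 w)%N.
by rewrite -mulnDr /nparts subnK ?lw // mulSnr.
Qed.

Section RowProducts.
Variable b : nat -> {poly int}.
Hypothesis b0 : b 0 = 1.
Hypothesis b_rec : forall k, b k.+1 = (1 + (2 * k + 1)%:R * 'X) * b k + theta (b k).

Definition row_prod N w : {poly int} := \prod_(k < N) b k ^+ nparts w k.

(** A new box in column k turns a row of length k into one of length k+1.  The
    case k = 0, a new row, is covered because nparts w 0 = 0. *)
Lemma row_prod_rcons N w (k : 'I_N) :
  lattice w -> extendable w k -> (k.+1 < N)%N ->
  row_prod N (rcons w k) =
  b k.+1 * b k ^+ (nparts w k).-1 * \prod_(j < N | j != k) b j ^+ nparts w j.
Proof.
move=> lw kw kN; rewrite /row_prod (bigD1 k) //= [RHS]mulrAC [LHS]mulrC; congr (_ * _).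
  pose k1 := Ordinal kN.
  have nk1 : k1 != k by rewrite -val_eqE /= gtn_eqF.
  rewrite (bigD1 k1) //= [in RHS](bigD1 k1) //= mulrA -exprS; congr (b _ ^+ _ * _).
    by rewrite /nparts /= !count_mem_rcons eqxx ltn_eqF // addn0 addn1 subSn.
  apply: eq_bigr => j /andP[]; rewrite -!val_eqE /= => jk jk1.
  congr (_ ^+ _); rewrite /nparts !count_mem_rcons.
  case: (nat_of_ord j) jk jk1 => [|j'] /=; first by rewrite !subnn.
  by rewrite eqSS ![_ == nat_of_ord k]eq_sym => /negPf-> /negPf->; rewrite !addn0.
congr (_ ^+ _); move: kw; rewrite /extendable /nparts !count_mem_rcons eqxx.
case: (nat_of_ord k) => [|k'] /=; first by rewrite !subnn.
by case: eqP => //; lia.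
Qed.

Lemma theta_pow k m : theta (b k ^+ m) =
  (b k.+1 * b k ^+ m.-1 - (1 + (2 * k + 1)%:R * 'X) * b k ^+ m) *+ m.
Proof.
case: m => [|m]; first by rewrite expr0 theta1.
by rewrite thetaX b_rec /= exprS; ring.
Qed.

(** Let r be the number of rows.  Applied to a row of length k, theta gives
    b (k+1) minus (1 + (2k+1) X) b k: the row grows, and there remains a
    correction.  The corrections add up to r (1 + X) + 2 n X, since the lengths
    add up to n.  The rate (n+1)(1 + X) + 2 n X thus leaves (n+1-r) b 1, the
    contribution of a new row with its weight n+1-r. *)
Lemma sum_box_weight n w : size w = n -> lattice w -> all (gtn n) w ->
  \sum_(k <- [seq k <- iota 0 n.+1 | extendable w k])
     box_weight w k *: row_prod n.+2 (rcons w k)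
  = rate n * row_prod n.+2 w + theta (row_prod n.+2 w).
Proof.
move=> sw lw aw; set N := n.+2; set P := row_prod N w.
have last0 : count_mem n.+1 w = 0%N by exact: (count_mem_ge aw).
have mn := nparts_oversize aw.
have sumr : (\sum_(k < N) (nparts w k)%:R = (count_mem 0%N w)%:R :> {poly int}).
  by rewrite -natr_sum -(sum_nparts n.+1 lw) last0 addn0.
have sumn : (\sum_(k < N) (k * nparts w k)%:R = n%:R :> {poly int}).
  rewrite -natr_sum -[in RHS]sw; congr (_%:R).
  rewrite -(@sum_count_mem n.+1 w) ?(sum_nparts_size n.+1 lw) ?last0 ?muln0 ?addn0 //.
    by rewrite -(sum_nparts_size n.+1 lw) last0 muln0 addn0.
  by apply: sub_all aw => x /=; lia.
pose R (k : 'I_N) : {poly int} :=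
  b k.+1 * b k ^+ (nparts w k).-1 * \prod_(j < N | j != k) b j ^+ nparts w j.
have thetaP : theta P = \sum_(k < N) (nparts w k)%:R * R k
    - ((1 + 'X) * (count_mem 0%N w)%:R + 2%:R * 'X * n%:R) * P.
  rewrite /P /row_prod theta_prod -sumr -sumn !mulr_sumr -big_split /= mulr_suml -sumrB.
  apply: eq_bigr => k _; rewrite theta_pow [in RHS](bigD1 k) //= /R.
  by move: (\prod_(j | _) _) => Q; rewrite natrM natrD; ring.
(* For k > 0 not extendable, and for k = n+1, nparts w k = 0, so that all k < N
   may be summed over. *)
rewrite big_filter -[iota 0 n.+1]/(index_iota 0 n.+1) big_mkord.
rewrite (big_ord_widen_cond N (extendable w)
          (fun k => box_weight w k *: row_prod N (rcons w k))) // big_mkcond.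
rewrite (eq_bigr (fun k : 'I_N => (nparts w k)%:R * R k +
   (if k == ord0 then (n.+1%:R - (count_mem 0%N w)%:R) * ((1 + 'X) * P) else 0))).
  rewrite big_split /= -big_mkcond big_pred1_eq thetaP /rate.
  by move: (\sum_k _) => S; ring.
move=> k _; rewrite -val_eqE /=.
have [k0|k0] := eqVneq (nat_of_ord k) 0%N.
  have ek : extendable w k by rewrite k0.
  have m0 : nparts w k = 0%N by rewrite k0 /nparts subnn.
  have kn : (k < n.+1)%N by rewrite k0.
  rewrite ek kn row_prod_rcons // m0 mul0r add0r k0.
  have -> : b 1 = 1 + 'X by rewrite b_rec b0 theta1; ring.
  rewrite /P /row_prod [in RHS](bigD1 k) //= m0 !expr0 mulr1 mul1r.
  by rewrite /box_weight eqxx sw scalerBl -!natz !scaler_nat mulrBl !mulr_natl.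
rewrite addr0; case: ifP => [/andP[kw kn]|nkw].
  rewrite row_prod_rcons // /box_weight (negPf k0) -/(R k).
  by rewrite -natz scaler_nat mulr_natl.
suff -> : nparts w k = 0%N by rewrite mul0r.
have [-> //|kn] := eqVneq (nat_of_ord k) n.+1.
have {}kn : (k < n.+1)%N by rewrite ltn_neqAle kn -ltnS ltn_ord.
by move: nkw; rewrite /extendable (negPf k0) kn andbT lt0n => /negbFE/eqP.
Qed.
End RowProducts.

(** The right-hand side of the theorem, seen through column words. *)
Definition word_sum n : {poly int} :=
  \sum_(w <- lattice_words n) word_weight w *: row_prod eulerianB n.+1 w.

Lemma word_sum_rec n : word_sum n.+1 = rate n * word_sum n + theta (word_sum n).
Proof.
rewrite /word_sum {1}/lattice_words -/lattice_words big_allpairs_dep /=.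
rewrite theta_sum mulr_sumr -big_split /= !big_seq; apply: eq_bigr => w ww.
have [sw lw aw] := lattice_words_lattice ww.
have -> : row_prod eulerianB n.+1 w = row_prod eulerianB n.+2 w.
  by rewrite {2}/row_prod big_ord_recr /= (nparts_oversize aw) mulr1.
under eq_bigr => k _ do rewrite word_weight_rcons -scalerA.
rewrite -scaler_sumr (sum_box_weight eulerianB0 eulerianB_rec sw lw aw).
by rewrite thetaZ scalerDr scalerAr.
Qed.

Lemma word_sum_narayana n : word_sum n = n`!%:R * narayanaB n.
Proof.
elim: n => [|n IH].
  rewrite /word_sum big_seq1 /word_weight big_ord0 scale1r /row_prod big_ord1 mul1r.
  by rewrite /narayanaB big_ord1 /= eulerianB0 expr1n scale1r.
have thetaMnl c p : theta (c%:R * p) = c%:R * theta p.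
  by rewrite !mulr_natl -!scaler_nat thetaZ.
by rewrite word_sum_rec IH factS natrM mulrAC narayanaB_rec thetaMnl; ring.
Qed.

(** * Standard tableaux and their column words *)

Section Tableaux.
Variable n : nat.
Implicit Type T : filling n.

(** Standardness without reference to a partition: the shape is the support of
    T, and the last two conditions make it closed downwards. *)
Record tableau T : Prop := Tableau {
  tableau_surj : forall e : 'I_n.+1, (0 < e)%N -> exists b, T b = e;
  tableau_inj : forall b b', (0 < T b)%N -> T b = T b' -> b = b';
  tableau_row : forall r c c' : 'I_n, (c < c')%N -> (0 < T (r, c'))%N ->
    (0 < T (r, c) < T (r, c'))%N;
  tableau_col : forall c r r' : 'I_n, (r < r')%N -> (0 < T (r', c))%N ->
    (0 < T (r, c) < T (r', c))%N }.

Lemma card_ltn_ord m : (m <= n)%N -> #|[set c : 'I_n | (c < m)%N]| = m.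
Proof.
move=> mn; rewrite -sum1dep_card -(big_ord_widen n (fun _ => 1%N)) //.
by rewrite sum1_card card_ord.
Qed.

Lemma downset_ord (A : {set 'I_n}) :
  (forall c c' : 'I_n, (c < c')%N -> c' \in A -> c \in A) ->
  forall c : 'I_n, (c \in A) = (c < #|A|)%N.
Proof.
move=> downA c; apply/idP/idP => [cA|].
  rewrite -[leqLHS](@card_ltn_ord c.+1) //; apply/subset_leq_card/subsetP => d.
  rewrite inE ltnS leq_eqVlt => /predU1P[/val_inj->//|/downA]; exact.
apply: contraLR => cA; rewrite -leqNgt -[leqRHS](card_ltn_ord (ltnW (ltn_ord c))).
apply/subset_leq_card/subsetP => d dA; rewrite inE ltnNge; apply: contra cA.
by rewrite leq_eqVlt => /predU1P[/val_inj->//|/downA]; apply.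
Qed.

Lemma tableau_rowE T r c : tableau T ->
  (0 < T (r, c))%N = (c < #|[set c : 'I_n | (0 < T (r, c))%N]|)%N.
Proof.
move=> tT; rewrite -downset_ord ?inE // => d d' dd'; rewrite !inE.
by case/(tableau_row tT dd')/andP.
Qed.

Lemma SYTP T : reflect (tableau T) (T \in SYT n).
Proof.
rewrite inE; apply: (iffP existsP) => [[la /andP[/andP[/forallP dec _]]]|tT].
  case/and4P => /forallP shape /forallP fill /forallP rows /forallP cols.
  have shp r c : (0 < T (r, c))%N = (c < la r)%N by have /forallP/(_ c)/eqP := shape r.
  split.
  - move=> e e0; have := fill e; rewrite e0 /= => /cards1P[b /setP/(_ b)].
    by rewrite !inE eqxx => /eqP Eb; exists b.
  - move=> b b' b0 E; have := fill (T b); rewrite b0 /= => /cards1P[a Ea].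
    move/setP: Ea => Ea; have := Ea b; have := Ea b'; rewrite !inE -E eqxx.
    by move=> /esym/eqP-> /esym/eqP->.
  - move=> r c c' cc'; rewrite shp => c'la.
    have /forallP/(_ c)/forallP/(_ c')/implyP-> := rows r; last by rewrite cc'.
    by rewrite shp andbT (ltn_trans cc').
  - move=> c r r' rr'; rewrite shp => cla.
    have /forallP/(_ r)/forallP/(_ r')/implyP-> := cols c; last by rewrite rr'.
    rewrite shp andbT; apply: (leq_trans cla).
    by have /forallP/(_ r')/implyP := dec r; apply; apply: ltnW.
pose la r : 'I_n.+1 := inord #|[set c : 'I_n | (0 < T (r, c))%N]|.
have laE r : la r = #|[set c : 'I_n | (0 < T (r, c))%N]| :> nat.
  by rewrite inordK // ltnS -[leqRHS](card_ord n) max_card.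
have shp r c : (0 < T (r, c))%N = (c < la r)%N by rewrite laE -tableau_rowE.
have fill (e : 'I_n.+1) : (0 < e)%N -> #|[set b | T b == e]| = 1%N.
  move=> e0; have [b Eb] := tableau_surj tT e0; apply/eqP/cards1P; exists b.
  apply/setP => b'; rewrite !inE; apply/eqP/eqP => [Eb'|-> //].
  by apply/esym/(tableau_inj tT); rewrite Eb ?Eb'.
exists (finfun la); apply/andP; split; [apply/andP; split|].
- apply/forallP => r; apply/forallP => r'; rewrite !ffunE !laE; apply/implyP.
  rewrite leq_eqVlt => /predU1P[/val_inj->//|rr'].
  apply/subset_leq_card/subsetP => c; rewrite !inE => /(tableau_col tT rr').
  by case/andP.
- under eq_bigr => r _ do rewrite ffunE laE -sum1dep_card big_mkcond.
  rewrite pair_big /= -big_mkcond.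
  rewrite (partition_big T (fun e => e != ord0)) /=; last first.
    by case=> r c /=; rewrite lt0n.
  rewrite (eq_bigr (fun=> 1%N)) => [|e e0].
    by rewrite sum1_card cardC1 card_ord.
  rewrite -[RHS](fill e) ?lt0n // -sum1dep_card; apply: eq_bigl => -[r c] /=.
  by apply: andb_idl => /eqP->; rewrite lt0n.
apply/and4P; split.
- by apply/forallP => r; apply/forallP => c; rewrite ffunE shp.
- by apply/forallP => e; apply/implyP => /fill/eqP.
- apply/forallP => r; apply/forallP => c; apply/forallP => c'; rewrite ffunE -shp.
  by apply/implyP => /andP[cc' /(tableau_row tT cc')/andP[]].
- apply/forallP => c; apply/forallP => r; apply/forallP => r'; rewrite ffunE -shp.
  by apply/implyP => /andP[cc' /(tableau_col tT cc')/andP[]].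
Qed.

Definition col_of T (e : nat) : nat :=
  if [pick b | T b == e :> nat] is Some b then nat_of_ord b.2 else 0.

Definition col_word T : seq nat := [seq col_of T e | e <- iota 1 n].

Lemma size_col_word T : size (col_word T) = n.
Proof. by rewrite size_map size_iota. Qed.

Lemma col_ofE T b : tableau T -> (0 < T b)%N -> col_of T (T b) = b.2.
Proof.
move=> tT b0; rewrite /col_of; case: pickP => [b' /eqP/val_inj E|/(_ b)]; last by rewrite eqxx.
by rewrite (tableau_inj tT b0 (esym E)).
Qed.

Lemma nth_col_word T e : (0 < e <= n)%N -> nth 0%N (col_word T) e.-1 = col_of T e.
Proof.
case: e => // e /andP[_ en]; rewrite (nth_map 0%N) ?size_iota //.
by rewrite nth_iota // add1n.
Qed.

(** The sizes of the columns at time i can be read off the prefix of length i of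
    the word; sorting indices and row lengths depend on nothing else. *)
Lemma count_col_word T k i : tableau T -> (i <= n)%N ->
  count_mem k (take i (col_word T)) =
  #|[set b : 'I_n * 'I_n | (b.2 == k :> nat) && (0 < T b <= i)%N]|.
Proof.
move=> tT; elim: i => [|i IH] le_in.
  rewrite take0; apply/esym/eqP; rewrite cards_eq0; apply/eqP/setP => b.
  by rewrite !inE leqn0 lt0n andNb andbF.
rewrite (take_nth 0%N) ?size_col_word // count_mem_rcons IH; last exact: ltnW.
rewrite (@nth_col_word T i.+1) //.
have [b Eb] := tableau_surj tT (e := inord i.+1) ltac:(by rewrite inordK).
have {}Eb : T b = i.+1 :> nat by rewrite Eb inordK.
have -> : col_of T i.+1 = b.2 by rewrite -Eb col_ofE // Eb.
rewrite -!sum1dep_card big_mkcond [RHS]big_mkcond /= [RHS](bigD1 b) //=.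
rewrite [in LHS](bigD1 b) //= Eb leqnn ltnn !andbF.
rewrite andbT add0n addnC; congr (_ + _)%N; first by case: eqP.
apply: eq_bigr => b' nb; congr (if _ && _ then _ else _).
rewrite [(_ <= i.+1)%N]leq_eqVlt ltnS; case: eqP => //= E.
case/eqP: nb; apply: (tableau_inj tT); last by apply: val_inj; rewrite /= E.
by rewrite E.
Qed.

(** The left neighbour of a box holds a smaller entry, so at any time column k
    has at least as many boxes as column k+1. *)
Lemma col_word_lattice T : tableau T -> col_word T \in lattice_words n.
Proof.
move=> tT; apply: mem_lattice_words (size_col_word T) _ => i k.
wlog le_in : i / (i <= n)%N => [wl|].
  have [/wl//|lt_ni] := leqP i n; have := wl n (leqnn n).
  by rewrite !take_oversize // size_col_word // ltnW.
rewrite !count_col_word //.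
(* h sends a box outside of the first column to its left neighbour. *)
pose h (b : 'I_n * 'I_n) : 'I_n * 'I_n := (b.1, insubd b.2 b.2.-1).
have val_h b : (h b).2 = b.2.-1 :> nat.
  by rewrite /= val_insubd (leq_ltn_trans (leq_pred _) (ltn_ord b.2)).
rewrite -(card_in_imset (f := h)).
  apply/subset_leq_card/subsetP => _ /imsetP[b + ->].
  rewrite !inE val_h => /andP[/eqP b2 /andP[b0 bi]].
  rewrite b2 eqxx /=; case: b b0 bi b2 => r c /= b0 bi b2.
  have lt : (insubd c c.-1 < c)%N by have := val_h (r, c); rewrite /= => ->; rewrite b2.
  by have /andP[-> /ltnW /leq_trans->] := tableau_row tT lt b0.
move=> [r c] [r' c']; rewrite !inE /= => /andP[/eqP E _] /andP[/eqP E' _] [-> _].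
by congr pair; apply: val_inj; rewrite /= E E'.
Qed.

(** Columns are filled upwards, so the word also determines the row of every
    entry. *)
Lemma count_before T b : tableau T -> (0 < T b)%N ->
  count_mem (b.2 : nat) (take (T b).-1 (col_word T)) = b.1.
Proof.
case: b => r c tT b0; have bn := ltn_ord (T (r, c)).
rewrite count_col_word //=; last by rewrite -ltnS prednK // ltnW.
rewrite -[RHS](card_ltn_ord (ltnW (ltn_ord r))).
rewrite -[RHS](card_imset _ (f := fun r' => (r', c))); last by move=> ? ? [].
apply: eq_card => -[r' c']; rewrite inE /=.
apply/idP/imsetP => [/andP[/eqP/val_inj-> /andP[r0 lt]]|[s]].
  exists r' => //; rewrite inE ltnNge; apply/negP; rewrite leq_eqVlt.
  case/predU1P=> [/val_inj E|/(tableau_col tT)/(_ r0)].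
    by subst r'; move: lt; rewrite leqNgt prednK // leqnn.
  case/andP => _; rewrite ltnNge (leq_trans lt) ?leq_pred //.
rewrite inE => sr [-> ->]; rewrite eqxx /=.
by have /andP[-> ] := tableau_col tT sr b0; rewrite -[(_ <= _.-1)%N]ltnS prednK.
Qed.

Lemma col_word_inj : {in SYT n &, injective col_word}.
Proof.
move=> T T' /SYTP tT /SYTP tT' E.
have sub U U' : tableau U -> tableau U' -> col_word U = col_word U' ->
    forall b, (0 < U b)%N -> U' b = U b.
  move=> tU tU' EU b b0; have [b' Eb'] := tableau_surj tU' b0.
  have b'0 : (0 < U' b')%N by rewrite Eb'.
  have bn : (U b <= n)%N by rewrite -ltnS.
  suff E3 : b = b' by rewrite {1}E3.
  have E2 : b.2 = b'.2.
    apply: val_inj; rewrite /= -(col_ofE tU b0) -(col_ofE tU' b'0) Eb'.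
    by rewrite -!nth_col_word ?b0 ?bn // EU.
  have E1 : b.1 = b'.1.
    apply: val_inj.
    by rewrite /= -(count_before tU b0) -(count_before tU' b'0) Eb' EU E2.
  by rewrite [b]surjective_pairing E1 E2 -surjective_pairing.
apply/ffunP => b; have [b0|] := boolP (0 < T b)%N; first by rewrite (sub _ _ tT tT').
have [b0|b0 b0'] := boolP (0 < T' b)%N; first by rewrite (sub _ _ tT' tT).
by apply: val_inj; move: b0 b0'; rewrite /= -!eqn0Ngt => /eqP-> /eqP->.
Qed.

End Tableaux.

Section Surjectivity.
Variables (n : nat) (w : seq nat).
Hypothesis ww : w \in lattice_words n.

(** Entry e sits in column w_e, above the earlier entries of that column. *)
Definition at_box (b : 'I_n * 'I_n) (e : nat) : bool :=
  [&& (0 < e)%N, nth 0%N w e.-1 == b.2 & count_mem (b.2 : nat) (take e.-1 w) == b.1].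

Definition tableau_of : filling n :=
  [ffun b => odflt ord0 [pick e : 'I_n.+1 | at_box b e]].

Let sw : size w = n. Proof. by have [] := lattice_words_lattice ww. Qed.

Lemma at_box_uniq b (e e' : 'I_n.+1) : at_box b e -> at_box b e' -> e = e'.
Proof.
wlog ee' : e e' / (e < e')%N => [wl eb eb'|].
  by have [/wl->|/wl->|/val_inj] := ltngtP e e'.
move=> /and3P[e0 /eqP Ee /eqP Er] /and3P[e0' _ /eqP Er'].
have := @count_take_lt w e.-1 e'.-1 b.2; rewrite Er Er' ltnn sw => H.
have //: false by apply: H Ee; rewrite ?prednK // -ltnS ?prednK.
Qed.

Lemma tableau_ofP b (e : 'I_n.+1) : (0 < e)%N -> (tableau_of b == e) = at_box b e.
Proof.
move=> e0; rewrite ffunE; case: pickP => [e' be'|none] /=; last first.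
  by rewrite none; apply/negP => /eqP E; rewrite -E in e0.
by apply/eqP/idP => [<-//|be]; apply: at_box_uniq be' be.
Qed.

Lemma tableau_of_at b : (0 < tableau_of b)%N -> at_box b (tableau_of b).
Proof. by move=> b0; rewrite -tableau_ofP. Qed.

Lemma tableau_of_le (r c : 'I_n) (m : nat) :
  (m <= n)%N -> (r < count_mem (c : nat) (take m w))%N ->
  (0 < tableau_of (r, c) <= m)%N.
Proof.
move=> mn rc; have mw : (m <= size w)%N by rewrite sw.
have [e [em Ec Er]] := count_take_ivt mw rc.
have en : (e.+1 < n.+1)%N by rewrite ltnS (leq_trans em).
have /eqP-> : tableau_of (r, c) == Ordinal en.
  by rewrite tableau_ofP // /at_box /= Ec Er !eqxx.
by [].
Qed.

(** In a column, the counts give the order of the entries.  For rows: when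
    column c' reaches height r+1, the lattice condition says that the columns to
    its left have reached it before. *)
Lemma tableau_of_tableau : tableau tableau_of.
Proof.
split.
- move=> e e0; have en : (e.-1 < n)%N by rewrite prednK // -ltnS.
  have [_ _ aw] := lattice_words_lattice ww.
  have cn : (nth 0%N w e.-1 < n)%N by apply: (allP aw); rewrite mem_nth ?sw.
  have rn : (count_mem (nth 0%N w e.-1) (take e.-1 w) < n)%N.
    apply: leq_ltn_trans (count_size _ _) _.
    by rewrite size_take sw en.
  exists (Ordinal rn, Ordinal cn); apply/eqP; rewrite tableau_ofP //.
  by rewrite /at_box e0 !eqxx.
- move=> b b' b0 E; have := tableau_of_at b0; have := @tableau_of_at b'.
  rewrite -E => /(_ b0) /and3P[_ /eqP E2' /eqP E1'] /and3P[_ /eqP E2 /eqP E1].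
  have {}E2 : b.2 = b'.2 by apply: val_inj; rewrite /= -E2 -E2'.
  have {}E1 : b.1 = b'.1 by apply: val_inj; rewrite /= -E1 -E1' E2.
  by rewrite [b]surjective_pairing E1 E2 -surjective_pairing.
- move=> r c c' cc' b0; have /and3P[_ /eqP /= Ec /eqP Er] := tableau_of_at b0.
  set e := tableau_of (r, c') in b0 Ec Er *.
  have en : (e <= n)%N by rewrite -ltnS.
  have rc' : (r < count_mem (c' : nat) (take e w))%N.
    by rewrite -Er; apply: count_take_lt; rewrite ?sw ?prednK.
  have rc := leq_trans rc' (lattice_mono (lattice_words_take e ww) (ltnW cc')).
  have /andP[c0 ce] := tableau_of_le en rc.
  rewrite c0 ltn_neqAle ce andbT /=; apply/eqP => E.
  have /and3P[_ /eqP /= Ec' _] := tableau_of_at c0.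
  by move: cc'; rewrite -Ec' E Ec ltnn.
- move=> c r r' rr' b0; have /and3P[_ /eqP /= Ec /eqP Er] := tableau_of_at b0.
  set e := tableau_of (r', c) in b0 Ec Er *.
  have en : (e.-1 <= n)%N by apply: (leq_trans (leq_pred _)); rewrite -ltnS.
  have /andP[-> /=] : (0 < tableau_of (r, c) <= e.-1)%N.
    by apply: tableau_of_le; rewrite ?Er.
  by rewrite -ltnS prednK.
Qed.

Lemma col_word_tableau_of : col_word tableau_of = w.
Proof.
apply: (@eq_from_nth _ 0%N); rewrite size_col_word ?sw // => i lt_in.
rewrite (@nth_col_word _ _ i.+1) //.
have [b Eb] := tableau_surj tableau_of_tableau (e := inord i.+1) ltac:(by rewrite inordK).
have {}Eb : tableau_of b = i.+1 :> nat by rewrite Eb inordK.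
rewrite -Eb col_ofE ?Eb //; last exact: tableau_of_tableau.
have := @tableau_of_at b; rewrite Eb => /(_ isT)/and3P[_ /eqP/esym].
by [].
Qed.
End Surjectivity.

Lemma perm_col_words n :
  perm_eq [seq col_word T | T <- enum (SYT n)] (lattice_words n).
Proof.
apply: uniq_perm; rewrite ?uniq_lattice_words //.
  rewrite map_inj_in_uniq ?enum_uniq // => T T'; rewrite !mem_enum.
  exact: col_word_inj.
move=> w; apply/mapP/idP => [[T]|ww].
  by rewrite mem_enum => /SYTP tT ->; apply: col_word_lattice.
exists (tableau_of n w); last by rewrite col_word_tableau_of.
by rewrite mem_enum; apply/SYTP/tableau_of_tableau.
Qed.

Lemma col_size_subtableau n (T : filling n) k i : tableau T -> (i <= n)%N ->
  col_size k.+1 (subtableau T i) = count_mem k (take i (col_word T)).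
Proof.
move=> tT le_in; rewrite count_col_word // /col_size; apply: eq_card => b.
rewrite !inE ffunE eqSS; congr (_ && _).
by case: ifP => _; rewrite ?andbT ?andbF.
Qed.

(** The sorting index refers to the diagram that contains i+1, box_weight to the
    one before; the 1 added in the definition makes up for the new box. *)
Lemma sorting_indexE n (T : filling n) i : tableau T -> (i < n)%N ->
  sorting_index T i.+1 = box_weight (take i (col_word T)) (nth 0%N (col_word T) i).
Proof.
move=> tT lt_in.
rewrite /sorting_index /box_weight (@nth_col_word _ _ i.+1) // /col_of.
have [b Eb] := tableau_surj tT (e := inord i.+1) ltac:(by rewrite inordK).
case: pickP => [b' /eqP Eb'|/(_ b)]; last by rewrite Eb inordK // eqxx.
have col k : count_mem k (take i.+1 (col_word T)) =
    (count_mem k (take i (col_word T)) + (b'.2 == k :> nat))%N.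
  rewrite (take_nth 0%N) ?size_col_word // count_mem_rcons (@nth_col_word _ _ i.+1) //.
  by rewrite -Eb' col_ofE // Eb'.
case: (nat_of_ord b'.2) col => [|k] col /=.
  rewrite col_size_subtableau // col eqxx size_take size_col_word lt_in.
  by rewrite PoszD opprD addrA; exact: subrK.
rewrite !col_size_subtableau // !col eqxx gtn_eqF // /nparts /=.
have le := lattice_words_take i (col_word_lattice tT) k.
by rewrite addn0 PoszD -subzn // opprD addrA; exact: subrK.
Qed.

(** Conjugation of partitions: column k has one box for every row longer than k. *)
Lemma num_rowsE n (T : filling n) i :
  tableau T -> num_rows i.+1 T = nparts (col_word T) i.+1.
Proof.
move=> tT; pose la r := #|[set c : 'I_n | (0 < T (r, c))%N]|.
have cnt k : count_mem k (col_word T) = (\sum_(r < n) (k < la r))%N.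
  rewrite -[col_word T](take_size) size_col_word count_col_word //.
  rewrite -sum1dep_card big_mkcond.
  transitivity (\sum_(r < n) \sum_(c < n)
      if (c == k :> nat) && (0 < T (r, c) <= n) then 1 else 0)%N.
    by rewrite pair_bigA; apply: eq_bigr => -[r c] _.
  apply: eq_bigr => r _.
  have lan : (la r <= n)%N by rewrite -[leqRHS](card_ord n) max_card.
  have [kn|nk] := ltnP k n; last first.
    rewrite big1 => [|c _]; last by rewrite ltn_eqF // (leq_trans (ltn_ord c)).
    by rewrite ltnNge (leq_trans lan nk).
  rewrite (bigD1 (Ordinal kn)) //= eqxx big1 => [|c].
    have -> : (T (r, Ordinal kn) <= n)%N by rewrite -ltnS.
    by rewrite addn0 andbT tableau_rowE // -/(la r) /=; case: (_ < _)%N.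
  by rewrite -val_eqE /= => /negPf->.
rewrite /nparts !cnt /num_rows -sum1dep_card big_mkcond /=.
apply/eqP; rewrite -(eqn_add2r (\sum_(r < n) (i.+1 < la r))) subnK.
  rewrite -big_split /=; apply/eqP/eq_bigr => r _; rewrite -/(la r).
  by case: (ltngtP (la r) i.+1); rewrite ?ltnS; lia.
by apply: leq_sum => r _; have := ltnW; lia.
Qed.

(** * The identity *)

Theorem theorem49 (n : nat) (hn : (1 <= n)%N) :
  (n`!)%:R *: narayanaB n =
  \sum_(T in SYT n)
    \prod_(1 <= i < n.+1) (sorting_index T i *: eulerianB i ^+ num_rows i T).
Proof.
rewrite scaler_nat -mulr_natl -word_sum_narayana /word_sum.
rewrite -(perm_big _ (perm_col_words n)) big_map big_enum /=.
apply: eq_bigr => T /SYTP tT.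
rewrite big_add1 /= big_mkord scaler_prod; congr (_ *: _).
  rewrite /word_weight size_col_word; apply: eq_bigr => i _.
  by rewrite sorting_indexE.
rewrite /row_prod big_ord_recl /= eulerianB0 expr1n mul1r; apply: eq_bigr => i _.
by rewrite num_rowsE.
Qed.
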